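(* Let $G$ be a simple connected graph with $n\ge 2$ vertices and $m$ edges, let $\alpha$ be a real number and let $t\ge 1$ be an integer. Then $$DEE(G)\geq e^{\sqrt{\frac{S_{t+1}}{S_{t}}}}+\frac{n-1}{e^{\frac{1}{n-1}\sqrt{\frac{S_{t+1}}{S_{t}}}}},$$ where $S_{t}=\sum_{i=1}^{n}\left(M_{i}^{(t)}\right)^{2}$. Moreover, equality holds if and only if $G$ is the complete graph $K_{n}$.
   Context: Let $G$ be a simple connected graph with vertex set $\{v_1,\dots,v_n\}$. Its distance matrix $D(G)=(d_{ij})$ is the $n\times n$ matrix whose entry $d_{ij}$ is the distance (length of a shortest path) between $v_i$ and $v_j$. The $D$-eigenvalues $\mu_1\ge\mu_2\ge\cdots\ge\mu_n$ of $G$ are the (real) eigenvalues of $D(G)$, counted with multiplicity. The distance Estrada index of $G$ is $DEE(G)=\sum_{i=1}^n e^{\mu_i}$. The distance degree of $v_i$ is $D_i=\sum_{j=1}^n d_{ij}$. For a fixed real number $\alpha$, the sequence $M_i^{(1)},M_i^{(2)},\ldots$ is defined for each $i=1,\dots,n$ by $M_i^{(1)}=D_i^{\alpha}$ and, for $t\ge 2$, $M_i^{(t)}=\sum_{j=1}^n d_{ij}M_j^{(t-1)}$. *)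

(* Defs.v *)
From HB Require Import structures.
From mathcomp Require Import all_boot all_order all_algebra.
From mathcomp Require Import reals sequences exp.
From mathcomp.real_closed Require Import polyrcf complex.

Set Implicit Arguments.
Unset Strict Implicit.
Unset Printing Implicit Defensive.

Import Order.TTheory GRing.Theory Num.Theory.
Local Open Scope ring_scope.

(* A simple graph on the vertices v_1, ..., v_n is a symmetric irreflexive    *)
(* relation on 'I_n.                                                          *)

Definition simple_graph n (e : rel 'I_n) := symmetric e /\ irreflexive e.

Definition connected_graph n (e : rel 'I_n) := forall u v, connect e u v.

Definition complete_graph n (e : rel 'I_n) := forall u v, e u v = (u != v).

Definition edge_set n (e : rel 'I_n) : {set {set 'I_n}} :=
  [set [set uv.1; uv.2] | uv : 'I_n * 'I_n & e uv.1 uv.2].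

Definition has_path_of_length n (e : rel 'I_n) (u v : 'I_n) (k : nat) : bool :=
  [exists p : k.-tuple 'I_n, [&& path e u p, last u p == v & uniq (u :: p)]].

(* A path repeats no vertex, so its length is at most n - 1; the value is n   *)
(* when v is not reachable from u.                                            *)
Definition gdist n (e : rel 'I_n) (u v : 'I_n) : nat :=
  \big[minn/n]_(k < n | has_path_of_length e u v k) k.

Definition distance_matrix (R : realType) n (e : rel 'I_n) : 'M[R]_n :=
  \matrix_(i, j) (gdist e i j)%:R.

(* The real eigenvalues of A, in nonincreasing order, each repeated according *)
(* to its multiplicity as a root of the characteristic polynomial.            *)
Definition eigenvalues (R : realType) n (A : 'M[R]_n) : seq R :=
  let p := char_poly A in
  rev (flatten [seq nseq (mup x p) x | x <- rootsR p]).

Lemma eigenvalues_perm (R : realType) n (A : 'M[R]_n) (s : seq R) :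
  char_poly A = \prod_(x <- s) ('X - x%:P) -> perm_eq (eigenvalues A) s.
Proof.
move=> Ap; apply/allP => y _ /=; apply/eqP.
have p0 : char_poly A != 0 by rewrite monic_neq0 // char_poly_monic.
rewrite /eigenvalues count_rev count_flatten sumnE big_map big_map.
have E x : count_mem y (nseq (mup x (char_poly A)) x) = if x == y then mup y (char_poly A) else 0%N.
  by rewrite count_nseq /=; case: eqP => [->|]; rewrite ?mul1n.
rewrite (eq_bigr _ (fun x _ => E x)) -big_mkcond /= big_const_seq iter_addn_0.
rewrite count_uniq_mem; last by apply: uniq_roots.
have -> : (y \in rootsR (char_poly A)) = root (char_poly A) y.
  by have := roots_on_rootsR p0 y; rewrite in_itv /= => <-.
rewrite -(mu_prod_XsubC y s) -Ap.
by case: (boolP (root _ _)) => [_|/mupNroot ->]; rewrite ?muln1.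
Qed.

Lemma sym_char_poly_splits (R : realType) n (A : 'M[R]_n) : A^T = A ->
  exists s : seq R, char_poly A = \prod_(x <- s) ('X - x%:P).
Proof.
move=> As; pose f := real_complex R; pose B : 'M[R[i]]_n := map_mx f A.
have Bh : B \is hermsymmx.
  apply/is_hermitianmxP; rewrite expr0 scale1r; apply/matrixP=> i j.
  by rewrite !mxE -{1}As mxE /= /f /=; simpc.
have Bn : B \is normalmx by apply: hermitian_normalmx.
have := orthomx_spectralP Bn.
set P := spectralmx B; set sp := spectral_diag B => Beq.
have Pu : P \in unitmx by apply: spectral_unit.
have cB : char_poly B = char_poly (diag_mx sp).
  have similar : char_poly_mx B = map_mx polyC (invmx P) *m char_poly_mx (diag_mx sp) *m map_mx polyC P.
    rewrite /char_poly_mx mulmxBr mulmxBl -!map_mxM -Beq; congr (_ - _).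
    by rewrite mul_mx_scalar -scalemxAl -map_mxM mulVmx // map_mx1 scalemx1.
  rewrite /char_poly similar !det_mulmx mulrC mulrA -det_mulmx -map_mxM mulmxV //.
  by rewrite map_mx1 det1 mul1r.
have real := hermitian_spectral_diag_real Bh.
exists [seq complex.Re (sp ord0 i) | i : 'I_n].
apply: (map_poly_inj f); rewrite map_char_poly -/B cB char_poly_trig ?diag_mx_is_trig //.
rewrite big_image /= rmorph_prod; apply: eq_bigr => i _.
rewrite rmorphB /= map_polyX map_polyC mxE eqxx mulr1n; congr (_ - _%:P).
by move/mxOverP: real => /(_ ord0 i); rewrite -/sp; case: (sp ord0 i) => a b /complex_realP[x ->].
Qed.

(* For symmetric A the list eigenvalues A therefore has exactly n entries.   *)
Lemma char_poly_eigenvalues (R : realType) n (A : 'M[R]_n) : A^T = A ->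
  char_poly A = \prod_(x <- eigenvalues A) ('X - x%:P).
Proof.
move=> /sym_char_poly_splits[s As].
by rewrite (perm_big _ (eigenvalues_perm As)).
Qed.

Definition DEE (R : realType) n (e : rel 'I_n) : R :=
  \sum_(mu <- eigenvalues (distance_matrix R e)) expR mu.

Definition distance_degree (R : realType) n (e : rel 'I_n) (i : 'I_n) : R :=
  \sum_j distance_matrix R e i j.

(* M_i^(t); it is only meaningful for t >= 1 (t = 0 gives the same value as   *)
(* t = 1).                                                                    *)
Definition Mseq (R : realType) n (e : rel 'I_n) (alpha : R) (t : nat) :
    'I_n -> R :=
  iter t.-1 (fun M i => \sum_j distance_matrix R e i j * M j)
            (fun i => powR (distance_degree R e i) alpha).

Definition Ssum (R : realType) n (e : rel 'I_n) (alpha : R) (t : nat) : R :=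
  \sum_i Mseq e alpha t i ^+ 2.

(* Main.v *)
Require Import Defs.
From mathcomp Require Import all_boot all_order all_algebra.
From mathcomp Require Import reals sequences exp.
From mathcomp.real_closed Require Import complex.
From mathcomp Require Import ring lra zify.

Set Implicit Arguments.
Unset Strict Implicit.
Unset Printing Implicit Defensive.

Import Order.TTheory GRing.Theory Num.Theory.
Local Open Scope ring_scope.

(** The distance matrix D is symmetric, so D = P^* diag(s) P with P unitary over
    R[i] and s the real spectrum. For a real row vector x, put y = x P^*. The
    nonnegative weights w_k = |y_k|^2 turn the quadratic forms |x|^2, x D x^T
    and |x D|^2 into the sums of w_k, s_k w_k and s_k^2 w_k ([sqnorm_weight],
    [spectral_form], [sqnorm_mul_weight]).

    Let s_k0 be the largest eigenvalue. The entries of D are nonnegative, so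
    replacing an eigenvector by its entrywise absolute value in the Rayleigh
    quotient shows that |s_k| <= s_k0 for all k ([eigenvalue_norm_le]). The vector
    M^(t+1) is D applied to M^(t), hence S_(t+1) <= s_k0^2 S_t, that is, r <= s_k0
    for r = sqrt (S_(t+1) / S_t) ([Ssum_ratio_le]).

    The trace of D is 0, so the other n - 1 eigenvalues have mean
    a = - s_k0 / (n - 1), and comparing expR with its tangent line at a gives
    DEE >= expR s_k0 + (n - 1) expR a, with equality exactly when all of them
    equal a ([sum_expR_ge]). The right-hand side is nondecreasing in s_k0 >= 0
    ([expR_pair_mono]), which gives the bound.

    In case of equality, D - a I has rank at most one, so its 2 x 2 minors vanish
    ([rank_one_minors]). As D has zero diagonal, this says d_ij^2 = a^2 for
    all i != j. Some pair is an edge, so every distance is 1 and the graph is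
    complete ([equal_spectrum_complete]). Conversely, for K_n one has r = n - 1
    and all eigenvalues lie in {n - 1, -1}. On these two points expR agrees
    with an affine function, so the zero trace alone determines DEE
    ([complete_DEE]). *)

(** * Spectral decomposition of real symmetric matrices *)

Lemma char_poly_conj (F : fieldType) n (P A B : 'M[F]_n) :
  P \in unitmx -> A = invmx P *m B *m P -> char_poly A = char_poly B.
Proof.
move=> Pu AB.
have cAB : char_poly_mx A =
    map_mx polyC (invmx P) *m char_poly_mx B *m map_mx polyC P.
  rewrite /char_poly_mx mulmxBr mulmxBl -!map_mxM -AB; congr (_ - _).
  by rewrite mul_mx_scalar -scalemxAl -map_mxM mulVmx // map_mx1 scalemx1.
rewrite /char_poly cAB !det_mulmx mulrC mulrA -det_mulmx -map_mxM mulmxV //.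
by rewrite map_mx1 det1 mul1r.
Qed.

(** A = P^* diag(s) P with P unitary and s real. The factor P is complex
    because the spectral theorem is used over the algebraically closed
    field R[i]. *)
Definition spectral_data (R : realType) n (A : 'M[R]_n) (s : 'I_n -> R)
    (P : 'M[R[i]]_n) : Prop :=
  P \is unitarymx /\
  map_mx (real_complex R) A =
    P^t*%sesqui *m diag_mx (\row_k real_complex R (s k)) *m P.

Lemma symmetric_spectral (R : realType) n (A : 'M[R]_n) : A^T = A ->
  exists (s : 'I_n -> R) (P : 'M[R[i]]_n),
    spectral_data A s P /\ perm_eq (eigenvalues A) [seq s k | k : 'I_n].
Proof.
move=> As; pose f := real_complex R; pose B : 'M[R[i]]_n := map_mx f A.
have Bh : B \is hermsymmx.
  apply/is_hermitianmxP; rewrite expr0 scale1r; apply/matrixP=> i j.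
  by rewrite !mxE -{1}As mxE /= /f /=; simpc.
have /orthomx_spectralP := hermitian_normalmx Bh.
have /mxOverP sp_real := hermitian_spectral_diag_real Bh.
have Pun := spectral_unitarymx B.
move: (spectralmx B) (spectral_diag B) Pun sp_real => P sp Pun sp_real BE.
exists (fun k => complex.Re (sp 0 k)), P.
have spE : sp = \row_k f (complex.Re (sp 0 k)).
  apply/rowP => k; rewrite mxE.
  by have := sp_real 0 k; case: (sp 0 k) => a b /complex_realP[x ->].
split; first by split=> //; rewrite -(invmx_unitary Pun) -spE.
apply: eigenvalues_perm; apply: (map_poly_inj f).
rewrite map_char_poly (char_poly_conj (unitarymx_unit Pun) BE).
rewrite char_poly_trig ?diag_mx_is_trig // big_image /= rmorph_prod.
apply: eq_bigr => k _; rewrite rmorphB /= map_polyX map_polyC !mxE eqxx mulr1n.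
by congr (_ - _%:P); move/rowP: spE => /(_ k) ->; rewrite mxE.
Qed.

(** The squared modulus of the k-th coordinate of x in the orthonormal basis
    formed by the rows of P. *)
Definition weight (R : realType) n (P : 'M[R[i]]_n) (x : 'rV[R]_n)
    (k : 'I_n) : R :=
  let y := (map_mx (real_complex R) x *m P^t*%sesqui) 0 k in
  complex.Re y ^+ 2 + complex.Im y ^+ 2.

Lemma weight_ge0 (R : realType) n (P : 'M[R[i]]_n) x k : 0 <= weight P x k.
Proof. by rewrite addr_ge0 // sqr_ge0. Qed.

(** Unitarity of P is not needed here; the lemma is applied to A, to the identity
    and to A^2, which share the same P. *)
Lemma spectral_form (R : realType) n (A : 'M[R]_n) (s : 'I_n -> R)
    (P : 'M[R[i]]_n) (x : 'rV[R]_n) :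
  map_mx (real_complex R) A =
    P^t*%sesqui *m diag_mx (\row_k real_complex R (s k)) *m P ->
  (x *m A *m x^T) 0 0 = \sum_k s k * weight P x k.
Proof.
move=> AE; apply: (@complexI R); rewrite rmorph_sum /=.
pose xc := map_mx (real_complex R) x.
have -> : real_complex R ((x *m A *m x^T) 0 0) =
    (map_mx (real_complex R) (x *m A *m x^T)) 0 0 by rewrite [RHS]mxE.
rewrite !map_mxM /= AE -/xc !mulmxA -mulmxA.
have -> : P *m map_mx (real_complex R) x^T = (xc *m P^t*)^t*%sesqui.
  rewrite trmx_mul map_mxM /= !map_trmx trmxK; congr (_ *m _).
    by apply/matrixP=> i j; rewrite !mxE conjCK.
  by apply/matrixP=> i j; rewrite !mxE /=; simpc.
rewrite mxE; apply: eq_bigr => k _.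
rewrite mul_mx_diag !mxE -/xc.
rewrite rmorphM /= -[in RHS]/(xc *m _) /weight -/xc.
rewrite (add_Re2_Im2 ((xc *m P^t*%sesqui) 0 k)).
by rewrite sqr_normc [in RHS]mxE; ring.
Qed.

Lemma unitary_trmxC_mul (R : realType) n (P : 'M[R[i]]_n) :
  P \is unitarymx -> P^t*%sesqui *m P = 1%:M.
Proof. by move=> Pun; rewrite -invmx_unitary // mulVmx // unitarymx_unit. Qed.

Lemma sqnorm_weight (R : realType) n (P : 'M[R[i]]_n) (x : 'rV[R]_n) :
  P \is unitarymx -> (x *m x^T) 0 0 = \sum_k weight P x k.
Proof.
move=> Pun; rewrite -[X in X *m _]mulmx1 (@spectral_form _ _ _ (fun=> 1) P).
  by apply: eq_bigr => k _; rewrite mul1r.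
have -> : (\row__ real_complex R 1) = const_mx 1 :> 'rV_n.
  by apply/rowP => k; rewrite !mxE.
by rewrite diag_const_mx mulmx1 unitary_trmxC_mul // map_mx1.
Qed.

Lemma sqnorm_mul_weight (R : realType) n (A : 'M[R]_n) s P (x : 'rV[R]_n) :
  A^T = A -> spectral_data A s P ->
  ((x *m A) *m (x *m A)^T) 0 0 = \sum_k s k ^+ 2 * weight P x k.
Proof.
move=> As [Pun AE]; rewrite trmx_mul As mulmxA -[x *m A *m A]mulmxA.
apply: spectral_form; rewrite map_mxM /= AE !mulmxA mulmxtVK //.
rewrite -[_ *m diag_mx _ *m diag_mx _]mulmxA; congr (_ *m _ *m _).
rewrite mulmx_diag; congr diag_mx.
by apply/rowP => k; rewrite !mxE -rmorphM.
Qed.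

Lemma trace_spectral (R : realType) n (A : 'M[R]_n) s P :
  spectral_data A s P -> \tr A = \sum_k s k.
Proof.
move=> [Pun AE]; apply: (@complexI R).
rewrite -[LHS]/(real_complex R (\tr A)) -trace_map_mx AE -mulmxA mxtrace_mulC.
rewrite -mulmxA (unitarymxP Pun) mulmx1 mxtrace_diag rmorph_sum.
by apply: eq_bigr => k _; rewrite mxE.
Qed.

Lemma rayleigh_le (R : realType) n (A : 'M[R]_n) s P (M : R) (x : 'rV[R]_n) :
  spectral_data A s P -> (forall k, s k <= M) ->
  (x *m A *m x^T) 0 0 <= M * (x *m x^T) 0 0.
Proof.
move=> [Pun AE] sM; rewrite (spectral_form x AE) (sqnorm_weight x Pun).
by rewrite mulr_sumr ler_sum // => k _; rewrite ler_wpM2r ?weight_ge0.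
Qed.

(** The part of Perron-Frobenius theory that is needed: for a nonnegative
    symmetric matrix the largest eigenvalue is the spectral radius. *)
Lemma eigenvalue_norm_le (R : realType) n (A : 'M[R]_n) s P (M a : R) :
  (forall i j, 0 <= A i j) -> spectral_data A s P -> (forall k, s k <= M) ->
  eigenvalue A a -> `|a| <= M.
Proof.
move=> A0 sA sM /eigenvalueP[v vA v0].
pose w : 'rV[R]_n := \row_j `|v 0 j|.
have ww : (w *m w^T) 0 0 = (v *m v^T) 0 0.
  rewrite !mxE; apply: eq_bigr => j _.
  by rewrite !mxE -normrM ger0_norm // -expr2 sqr_ge0.
have vv_gt0 : 0 < (v *m v^T) 0 0.
  have [j vj] : exists j, v 0 j != 0.
    by apply/existsP; apply: contraNT v0 => /existsPn v0; apply/eqP/rowP => j;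
      rewrite mxE; apply/eqP; rewrite -[_ == _]negbK v0.
  rewrite mxE (bigD1 j) //= ltr_pwDl //.
    by rewrite !mxE -expr2 exprn_even_gt0.
  by apply: sumr_ge0 => i _; rewrite !mxE -expr2 sqr_ge0.
(* |a| |v|^2 = |v A v^T| <= w A w^T <= M |w|^2 = M |v|^2 for w = |v|. *)
rewrite -(ler_pM2r vv_gt0) -{2}ww; apply: le_trans (rayleigh_le w sA sM).
rewrite -(ger0_norm (ltW vv_gt0)) -normrM.
have -> : a * (v *m v^T) 0 0 = (v *m A *m v^T) 0 0.
  by rewrite vA -scalemxAl [RHS]mxE.
rewrite !mxE (le_trans (ler_norm_sum _ _ _)) // ler_sum // => j _.
rewrite !mxE normrM ler_wpM2r // (le_trans (ler_norm_sum _ _ _)) //.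
rewrite ler_sum // => i _.
by rewrite !mxE normrM (ger0_norm (A0 _ _)).
Qed.

Lemma sqnorm_mul_le (R : realType) n (A : 'M[R]_n) s P (M : R) (x : 'rV[R]_n) :
  A^T = A -> spectral_data A s P -> (forall k, `|s k| <= M) ->
  ((x *m A) *m (x *m A)^T) 0 0 <= M ^+ 2 * (x *m x^T) 0 0.
Proof.
move=> As sA sM; rewrite (sqnorm_mul_weight x As sA) (sqnorm_weight x sA.1).
rewrite mulr_sumr ler_sum // => k _; rewrite ler_wpM2r ?weight_ge0 //.
by rewrite -real_normK ?num_real // lerXn2r ?nnegrE // (le_trans _ (sM k)).
Qed.

(** If all eigenvalues but one equal a, then A - a I has rank at most one; this
    is the vanishing of its 2 x 2 minor on rows and columns i, j. *)
Lemma rank_one_minors (R : realType) n (A : 'M[R]_n) s P k0 (a : R) i j :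
  A^T = A -> spectral_data A s P -> (forall k, k != k0 -> s k = a) ->
  (A i i - a) * (A j j - a) = (A i j - a *+ (i == j)) ^+ 2.
Proof.
move=> As [Pun AE] sa.
pose B := map_mx (real_complex R) (A - a%:M).
(* Only the term k0 survives in P^* diag(s - a) P. *)
have BE u v : B u v = (P k0 u)^* * real_complex R (s k0 - a) * P k0 v.
  have -> : B = P^t*%sesqui *m diag_mx (\row_k real_complex R (s k - a)) *m P.
    rewrite /B map_mxB /= AE map_scalar_mx /=.
    have -> : diag_mx (\row_k real_complex R (s k - a)) =
        diag_mx (\row_k real_complex R (s k)) - (real_complex R a)%:M.
      by apply/matrixP => p q; rewrite !mxE rmorphB mulrnBl; case: eqP => [->|].
    rewrite mulmxBr mulmxBl mul_mx_scalar -scalemxAl unitary_trmxC_mul //.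
    by rewrite scalemx1.
  rewrite mul_mx_diag mxE (bigD1 k0) //= !mxE big1 ?addr0 // => k /sa sk.
  by rewrite !mxE sk subrr mulr0 mul0r.
have minor : B i i * B j j = B i j * B j i by rewrite !BE; ring.
apply: (@complexI R); move: minor; rewrite !mxE !eqxx -!rmorphM /= => ->.
by rewrite expr2 -{2}As mxE [in X in X = _](eq_sym j).
Qed.

(** * Graph distance *)

Lemma gdist_le n (e : rel 'I_n) u v k :
  (k < n)%N -> has_path_of_length e u v k -> (gdist e u v <= k)%N.
Proof.
move=> kn ek; rewrite /gdist.
have: Ordinal kn \in index_enum 'I_n by rewrite mem_index_enum.
elim: (index_enum _) => // i r IHr; rewrite inE big_cons.
case/predU1P => [<-|/IHr le_k].
  by rewrite ek geq_minl.
by case: ifP => // _; apply: leq_trans (geq_minr _ _) le_k.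
Qed.

(** The first alternative is the default value of the minimum, taken when v is
    not reachable from u. *)
Lemma gdist_attained n (e : rel 'I_n) u v :
  gdist e u v = n \/ has_path_of_length e u v (gdist e u v).
Proof.
rewrite /gdist; elim/big_ind: _ => [|a b|k]; [by left| |by right].
by rewrite /minn; case: ifP.
Qed.

Lemma has_path0 n (e : rel 'I_n) u v : has_path_of_length e u v 0 = (u == v).
Proof.
apply/existsP/idP => [[p]|uv]; first by rewrite [p]tuple0 /= => /andP[].
by exists [tuple]; rewrite /= uv.
Qed.

Lemma has_path1 n (e : rel 'I_n) u v :
  has_path_of_length e u v 1 = e u v && (u != v).
Proof.
apply/existsP/idP => [[p]|/andP[euv uv]].
  case: (tupleP p) => x q; rewrite [q]tuple0 /= inE !andbT.
  by case/and3P => eux /eqP <- ux; rewrite eux.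
by exists [tuple v]; rewrite /= inE euv uv eqxx.
Qed.

Lemma has_path_sym n (e : rel 'I_n) u v k : symmetric e ->
  has_path_of_length e u v k -> has_path_of_length e v u k.
Proof.
move=> es /existsP[p /and3P[ep /eqP pv pu]]; apply/existsP.
have sz : size (rev (belast u p)) == k.
  by rewrite size_rev size_belast size_tuple.
have rE : v :: rev (belast u p) = rev (u :: p).
  by rewrite [u :: p]lastI rev_rcons pv.
exists (Tuple sz); apply/and3P; split=> /=.
- by rewrite -pv rev_path (eq_path (e' := e)) // => x y; rewrite es.
- by case: (tval p) => [|y q] /= in pv *; rewrite ?pv ?rev_cons ?last_rcons.
- by rewrite -[X in is_true X]/(uniq (v :: _)) rE rev_uniq.
Qed.

Lemma gdist_sym n (e : rel 'I_n) u v :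
  symmetric e -> gdist e u v = gdist e v u.
Proof.
move=> es; apply: eq_bigl => k; apply/idP/idP; exact: has_path_sym.
Qed.

Lemma gdist_refl n (e : rel 'I_n) u : gdist e u u = 0%N.
Proof.
apply/eqP; rewrite -leqn0; apply: gdist_le; last by rewrite has_path0.
exact: leq_ltn_trans (ltn_ord u).
Qed.

Lemma gdist_gt0 n (e : rel 'I_n) u v : u != v -> (0 < gdist e u v)%N.
Proof.
move=> uv; case: (gdist_attained e u v) => [->|].
  exact: leq_ltn_trans (ltn_ord u).
by case: (gdist e u v) => //; rewrite has_path0 (negPf uv).
Qed.

Lemma gdist_eq1 n (e : rel 'I_n) u v : (1 < n)%N -> irreflexive e ->
  (gdist e u v == 1%N) = e u v.
Proof.
move=> n1 ei; apply/eqP/idP => [d1|euv].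
  case: (gdist_attained e u v) => [dn|]; first by rewrite -dn d1 in n1.
  by rewrite d1 has_path1 => /andP[].
have uv : u != v by apply: contraTneq euv => ->; rewrite ei.
apply/eqP; rewrite eqn_leq gdist_gt0 // andbT.
by apply: gdist_le; rewrite ?has_path1 ?euv.
Qed.

Lemma connected_edge n (e : rel 'I_n) : (1 < n)%N -> connected_graph e ->
  exists u v, e u v.
Proof.
move=> n1 ec; pose u := Ordinal (ltnW n1); pose v := Ordinal n1.
have /connectP[[|w p] /= ep pv] := ec u v; first by [].
by exists u, w; case/andP: ep.
Qed.

(** * Convexity estimates for the exponential *)

Lemma expR_tangent (R : realType) (a y : R) :
  expR a * (1 + (y - a)) <= expR y ?= iff (y == a).
Proof.
have yE : expR y = expR a * expR (y - a) by rewrite -expRD addrC subrK.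
split; first by rewrite yE ler_pM2l ?expR_gt0 // expR_ge1Dx.
have [->|ya] := eqVneq y a; first by rewrite subrr addr0 mulr1 eqxx.
by apply: lt_eqF; rewrite yE ltr_pM2l ?expR_gt0 // expR_gt1Dx // subr_eq0.
Qed.

(** The function x |-> expR x + N expR (- x / N) is nondecreasing for x >= 0. *)
Lemma expR_pair_mono (R : realType) (N x y : R) : 0 < N -> 0 <= x -> x <= y ->
  expR x + N * expR (- (x / N)) <= expR y + N * expR (- (y / N)).
Proof.
move=> N0 x0 xy.
(* The tangent lines of the two terms at x have slopes expR x and
   - expR (- x / N), whose sum is nonnegative. *)
have [h1 _] := expR_tangent x y.
have [h2 _] := expR_tangent (- (x / N)) (- (y / N)).
have h3 : expR (- (x / N)) <= expR x.
  by rewrite ler_expR (le_trans _ x0) // oppr_le0 divr_ge0 // ltW.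
have h4 : N * (expR (- (x / N)) * (1 + (- (y / N) - - (x / N)))) <=
    N * expR (- (y / N)).
  by rewrite ler_pM2l.
have E : N * (expR (- (x / N)) * (1 + (- (y / N) - - (x / N)))) =
   expR (- (x / N)) * (N - (y - x)) by field; rewrite gt_eqF.
rewrite E in h4.
have h5 : 0 <= (expR x - expR (- (x / N))) * (y - x).
  by rewrite mulr_ge0 ?subr_ge0.
lra.
Qed.

(** When s has sum 0, the value a is the mean of the s k with k != k0. *)
Lemma sum_expR_ge (R : realType) n (s : 'I_n -> R) k0 :
  (1 < n)%N -> \sum_k s k = 0 ->
  let a := - (s k0 / (n%:R - 1)) in
  expR (s k0) + (n%:R - 1) * expR a <= \sum_k expR (s k)
    ?= iff [forall (k | k != k0), s k == a].
Proof.
move=> n1 s0 a.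
have N0 : (n%:R - 1 : R) != 0 by rewrite gt_eqF // subr_gt0 ltr1n.
have cN (c : R) : \sum_(k < n | k != k0) c = (n%:R - 1) * c.
  have -> : n%:R - 1 = n.-1%:R :> R by rewrite -subn1 natrB // ltnW.
  by rewrite sumr_const cardC1 card_ord mulr_natl.
rewrite (bigD1 k0 (F := fun k => expR (s k))) //=.
have -> : (n%:R - 1) * expR a = \sum_(k | k != k0) expR a * (1 + (s k - a)).
  rewrite -mulr_sumr big_split sumrB /= !cN mulr1.
  have -> : \sum_(k | k != k0) s k = - s k0.
    by move: s0; rewrite (bigD1 k0) //= addrC => /eqP; rewrite addr_eq0 => /eqP.
  by rewrite /a; field.
apply: (@leifD _ _ _ true); first exact/leif_refl.
by apply: leif_sum => k _; exact: expR_tangent.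
Qed.

(** * Spectrum of the distance matrix *)

Lemma distance_matrix_sym (R : realType) n (e : rel 'I_n) :
  symmetric e -> (distance_matrix R e)^T = distance_matrix R e.
Proof. by move=> es; apply/matrixP => i j; rewrite !mxE gdist_sym. Qed.

Lemma distance_matrix_trace (R : realType) n (e : rel 'I_n) :
  \tr (distance_matrix R e) = 0.
Proof. by apply: big1 => i _; rewrite mxE gdist_refl. Qed.

Lemma eigenvalue_spectrum (R : realType) n (A : 'M[R]_n) (s : 'I_n -> R) k :
  A^T = A -> perm_eq (eigenvalues A) [seq s i | i : 'I_n] -> eigenvalue A (s k).
Proof.
move=> As sE; rewrite eigenvalue_root_char char_poly_eigenvalues //.
by rewrite root_prod_XsubC (perm_mem sE) image_f.
Qed.

Lemma DEE_spectrum (R : realType) n (e : rel 'I_n) (s : 'I_n -> R) :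
  perm_eq (eigenvalues (distance_matrix R e)) [seq s i | i : 'I_n] ->
  DEE R e = \sum_k expR (s k).
Proof. by move=> sE; rewrite /DEE (perm_big _ sE) big_image. Qed.

Lemma MseqS (R : realType) n (e : rel 'I_n) (alpha : R) t i : (0 < t)%N ->
  Mseq e alpha t.+1 i = \sum_j distance_matrix R e i j * Mseq e alpha t j.
Proof. by case: t. Qed.

Lemma Ssum_sqnorm (R : realType) n (e : rel 'I_n) (alpha : R) t :
  let x := \row_j Mseq e alpha t j in Ssum e alpha t = (x *m x^T) 0 0.
Proof. by rewrite /= mxE; apply: eq_bigr => j _; rewrite !mxE expr2. Qed.

Lemma Mseq_row_mul (R : realType) n (e : rel 'I_n) (alpha : R) t :
  symmetric e -> (0 < t)%N ->
  \row_j Mseq e alpha t.+1 j = (\row_j Mseq e alpha t j) *m distance_matrix R e.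
Proof.
move=> es t0; apply/rowP => i; rewrite !mxE MseqS //; apply: eq_bigr => j _.
by rewrite !mxE mulrC gdist_sym.
Qed.

Lemma Ssum_ratio_le (R : realType) n (e : rel 'I_n) (alpha : R) t s P (M : R) :
  symmetric e -> (0 < t)%N -> spectral_data (distance_matrix R e) s P ->
  (forall k, `|s k| <= M) -> 0 <= M ->
  Num.sqrt (Ssum e alpha t.+1 / Ssum e alpha t) <= M.
Proof.
move=> es t0 sA sM M0.
rewrite -(ger0_norm M0) -sqrtr_sqr ler_wsqrtr // !Ssum_sqnorm Mseq_row_mul //.
set x := \row_j _.
have := sqnorm_mul_le x (distance_matrix_sym R es) sA sM.
have : 0 <= (x *m x^T) 0 0.
  by rewrite mxE sumr_ge0 // => j _; rewrite !mxE -expr2 sqr_ge0.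
(* If S_t = 0, the ratio is 0 by the convention on division by 0. *)
rewrite le_eqVlt => /predU1P[<- _|x0]; first by rewrite invr0 mulr0 sqr_ge0.
by rewrite ler_pdivrMr.
Qed.

Lemma equal_spectrum_complete (R : realType) n (e : rel 'I_n) s P k0 (a : R) :
  (1 < n)%N -> simple_graph e -> connected_graph e ->
  spectral_data (distance_matrix R e) s P -> (forall k, k != k0 -> s k = a) ->
  complete_graph e.
Proof.
move=> n1 [es ei] ec sA sa.
have dE u v : u != v -> (gdist e u v)%:R ^+ 2 = a ^+ 2 :> R.
  move=> uv; have := rank_one_minors u v (distance_matrix_sym R es) sA sa.
  by rewrite !mxE !gdist_refl !sub0r mulrNN -expr2 (negPf uv) subr0 => <-.
have [u0 [v0 e0]] := connected_edge n1 ec.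
have uv0 : u0 != v0 by apply: contraTneq e0 => ->; rewrite ei.
have a1 : a ^+ 2 = 1.
  rewrite -(dE _ _ uv0); move: e0; rewrite -(gdist_eq1 _ _ n1 ei) => /eqP ->.
  by rewrite expr1n.
move=> u v; have [->|uv] := eqVneq u v; first by rewrite ei.
rewrite -(gdist_eq1 _ _ n1 ei) -(eqr_nat R).
by rewrite -(eqrXn2 (n := 2)) ?ler0n ?ler01 // dE // a1 expr1n eqxx.
Qed.

(** * The complete graph *)

Lemma complete_graph_simple n (e : rel 'I_n) :
  complete_graph e -> simple_graph e.
Proof. by move=> ec; split=> [u v|u]; rewrite !ec ?eqxx // eq_sym. Qed.

Lemma complete_distance (R : realType) n (e : rel 'I_n) i j :
  (1 < n)%N -> complete_graph e ->
  distance_matrix R e i j = (i != j)%:R.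
Proof.
move=> n1 ec; have [_ ei] := complete_graph_simple ec.
rewrite mxE; have [->|ij] := eqVneq i j; first by rewrite gdist_refl.
by congr _%:R; apply/eqP; rewrite gdist_eq1 // ec.
Qed.

Lemma sum_neq (R : realType) n (x : 'I_n -> R) i :
  \sum_j (i != j)%:R * x j = \sum_j x j - x i.
Proof.
rewrite [in RHS](bigD1 i) //= addrAC subrr add0r (bigD1 i) //= eqxx mul0r add0r.
by apply: eq_bigr => j; rewrite eq_sym => ->; rewrite mul1r.
Qed.

Lemma complete_ratio (R : realType) n (e : rel 'I_n) (alpha : R) t :
  (1 < n)%N -> complete_graph e -> (0 < t)%N ->
  Num.sqrt (Ssum e alpha t.+1 / Ssum e alpha t) = n%:R - 1.
Proof.
move=> n1 ec; pose N : R := n%:R - 1.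
have N0 : 0 < N by rewrite subr_gt0 ltr1n.
(* D multiplies constant vectors by n - 1, so every M^(t) is constant. *)
have sumc (c : R) i : \sum_j distance_matrix R e i j * c = N * c.
  under eq_bigr do rewrite complete_distance //.
  by rewrite sum_neq sumr_const card_ord -mulr_natl mulrBl mul1r.
have Mc t' : exists2 c : R, 0 < c & forall i, Mseq e alpha t'.+1 i = c.
  elim: t' => [|t' [c c0 IH]].
    exists (powR N alpha) => [|i]; first by rewrite powR_gt0.
    rewrite /Mseq /= /distance_degree -[N]mulr1 -(sumc 1 i).
    by under [in RHS]eq_bigr do rewrite mulr1.
  exists (N * c) => [|i]; first by rewrite mulr_gt0.
  by rewrite MseqS // -(sumc c i); apply: eq_bigr => j _; rewrite IH.
case: t => // t _; have [c c0 ME] := Mc t.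
have -> : Ssum e alpha t.+1 = n%:R * c ^+ 2.
  rewrite /Ssum; under eq_bigr do rewrite ME.
  by rewrite sumr_const card_ord mulr_natl.
have -> : Ssum e alpha t.+2 = n%:R * (N * c) ^+ 2.
  rewrite /Ssum; under eq_bigr => i _.
    rewrite MseqS //; under eq_bigr do rewrite ME.
    rewrite sumc; over.
  by rewrite sumr_const card_ord mulr_natl.
have -> : n%:R * (N * c) ^+ 2 / (n%:R * c ^+ 2) = N ^+ 2.
  field; rewrite gt_eqF //= pnatr_eq0; lia.
by rewrite sqrtr_sqr ger0_norm // ltW.
Qed.

Lemma complete_eigenvalue (R : realType) n (e : rel 'I_n) (a : R) :
  (1 < n)%N -> complete_graph e ->
  eigenvalue (distance_matrix R e) a -> a = n%:R - 1 \/ a = -1.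
Proof.
move=> n1 ec /eigenvalueP[v va v0]; set S : R := \sum_j v 0 j.
have vj j : (a + 1) * v 0 j = S.
  move/rowP: va => /(_ j); rewrite !mxE.
  under eq_bigr do rewrite complete_distance // mulrC eq_sym.
  rewrite sum_neq -/S => /eqP; rewrite subr_eq => /eqP ->; ring.
have : (a + 1) * S = n%:R * S.
  rewrite {1}/S mulr_sumr; under eq_bigr do rewrite vj.
  by rewrite sumr_const card_ord mulr_natl.
(* Either a + 1 = n, or S = 0 and then (a + 1) v = 0. *)
have [S0 _|S0 /(mulIf S0) <-] := eqVneq S 0; last by left; rewrite addrK.
right; apply/eqP; rewrite -addr_eq0; apply: contraNT v0 => a1.
apply/eqP/rowP => j; rewrite mxE; apply: (mulfI a1).
by rewrite vj S0 mulr0.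
Qed.

Lemma complete_DEE (R : realType) n (e : rel 'I_n) :
  (1 < n)%N -> complete_graph e ->
  DEE R e = expR (n%:R - 1) + (n%:R - 1) * expR (-1).
Proof.
move=> n1 ec; have [es _] := complete_graph_simple ec.
have Ds := distance_matrix_sym R es.
have [s [P [sA sE]]] := symmetric_spectral Ds.
have s0 : \sum_k s k = 0.
  by rewrite -(trace_spectral sA) distance_matrix_trace.
have n0 : (n%:R : R) != 0 by rewrite pnatr_eq0; lia.
(* d is the slope of the line through the graph of expR at -1 and n - 1. *)
pose d : R := (expR (n%:R - 1) - expR (-1)) / n%:R.
have expE k : expR (s k) = expR (-1) + (s k + 1) * d.
  have [->|->] := complete_eigenvalue n1 ec (eigenvalue_spectrum k Ds sE).
    by rewrite /d; field.
  by rewrite addNr mul0r addr0.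
rewrite (DEE_spectrum sE); under eq_bigr do rewrite expE.
rewrite big_split /= -mulr_suml big_split /= s0 !sumr_const card_ord add0r.
by rewrite -[_ *+ n]mulr_natl /d; field.
Qed.

Theorem theorem2p1 (R : realType) (n m : nat) (e : rel 'I_n) (alpha : R)
    (t : nat) (n_ge2 : (2 <= n)%N) (e_simple : simple_graph e)
    (e_connected : connected_graph e) (e_edges : #|edge_set e| = m)
    (t_ge1 : (1 <= t)%N) :
  let r := Num.sqrt (Ssum e alpha t.+1 / Ssum e alpha t) in
  let bound := expR r + (n%:R - 1) / expR (1 / (n%:R - 1) * r) in
  bound <= DEE R e /\ (DEE R e = bound <-> complete_graph e).
Proof.
move=> r bound; have [es ei] := e_simple.
have N0 : 0 < n%:R - 1 :> R by rewrite subr_gt0 ltr1n.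
have boundE : bound = expR r + (n%:R - 1) * expR (- (r / (n%:R - 1))).
  by rewrite /bound mul1r expRN [_^-1 * r]mulrC.
have Ds := distance_matrix_sym R es.
have [s [P [sA sE]]] := symmetric_spectral Ds.
have s0 : \sum_k s k = 0.
  by rewrite -(trace_spectral sA) distance_matrix_trace.
have [k0 s_le] : exists k0, forall k, s k <= s k0.
  case: (@arg_maxP _ R _ (Ordinal n_ge2) xpredT s isT) => k0 _ sk0.
  by exists k0 => // k; apply: sk0.
have M0 : 0 <= s k0.
  have : \sum_k s k <= \sum_(k < n) s k0 by apply: ler_sum => k _.
  by rewrite s0 sumr_const card_ord pmulrn_lge0 // ltnW.
have s_norm k : `|s k| <= s k0.
  apply: (eigenvalue_norm_le _ sA s_le (eigenvalue_spectrum k Ds sE)) => i j.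
  by rewrite mxE ler0n.
have r_le : r <= s k0 by apply: Ssum_ratio_le sA s_norm M0.
have bound_le := expR_pair_mono N0 (sqrtr_ge0 _) r_le.
rewrite -boundE in bound_le.
have [DEE_ge DEE_eq] := sum_expR_ge k0 n_ge2 s0.
rewrite -(DEE_spectrum sE) in DEE_ge DEE_eq.
split; first exact: le_trans DEE_ge.
(* If DEE = bound, then all terms of the chain bound <= (value at s k0) <= DEE
   are equal. *)
split=> [DEE_bound|ec].
  have : [forall (k | k != k0), s k == - (s k0 / (n%:R - 1))].
    by rewrite -DEE_eq eq_le DEE_ge DEE_bound.
  move=> /forall_inP sa.
  apply: (equal_spectrum_complete n_ge2 e_simple e_connected sA).
  by move=> k /sa /eqP; exact.
by rewrite boundE complete_DEE // /r complete_ratio // divff // gt_eqF.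
Qed.
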